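(* Let $\varepsilon,\alpha,\beta\in(0,1/2]$. Let $\mathcal{H}$ be a finite candidate set and, for every pair $H,H'\in\mathcal{H}$, let $\psi_{H,H'}:\mathcal{Z}\to[-1,1]$ be a comparison function. Let $\mathcal{D}$ be a distribution over $\mathcal{Z}$ and assume there exists $H^*\in\mathcal{H}$ with $\mathrm{score}^\psi_{H^*}(\mathcal{D})\le0.1\alpha$. Then there exists an $\varepsilon$-user-level DP algorithm which, with probability at least $1-\beta$ (over its randomness and the input $\mathbf{x}\sim(\mathcal{D}^m)^n$), outputs $H\in\mathcal{H}$ with $\mathrm{score}^\psi_H(\mathcal{D})\le0.5\alpha$, as long as \[ n\ge\tilde{\Theta}\left(\frac{\log(|\mathcal{H}|/\beta)}{\varepsilon}+\frac{\log(|\mathcal{H}|/\beta)}{\alpha\varepsilon\sqrt{m}}+\frac{\log(|\mathcal{H}|/\beta)}{\alpha^2 m}\right). \]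
   Context: User-level DP: there are $n$ users each holding $m$ examples from $\mathcal{Z}$; two inputs in $\mathcal{Z}^{nm}$ are user-level neighbors if they differ only in one user's $m$ examples; an algorithm is $\varepsilon$-user-level DP if $\Pr[\mathbf{A}(\mathbf{x})\in S]\le e^\varepsilon\Pr[\mathbf{A}(\mathbf{x}')\in S]$ for all neighbors and all output sets $S$. Distributional scores: $\mathrm{pscore}^\psi_{H,H'}(\mathcal{D})=\mathbb{E}_{x\sim\mathcal{D}}[\psi_{H,H'}(x)]$ and $\mathrm{score}^\psi_H(\mathcal{D})=\max_{H'\in\mathcal{H}\setminus\{H\}}\mathrm{pscore}^\psi_{H,H'}(\mathcal{D})$. $\tilde{\Theta}$ hides polylogarithmic factors. *)

(* Defs.v *)
From HB Require Import structures.
From mathcomp Require Import all_boot all_order all_algebra.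
From mathcomp Require Import all_classical all_reals all_analysis.

Set Implicit Arguments.
Unset Strict Implicit.
Unset Printing Implicit Defensive.

Import Order.TTheory GRing.Theory Num.Theory.
Import numFieldNormedType.Exports.

Local Open Scope classical_set_scope.
Local Open Scope ring_scope.

(* A finite type with the discrete sigma-algebra. Measurable types are pointed
   in the library, so the alias carries an element of the type. *)
Definition discrete (H : finType) (h0 : H) : Type := H.

Section discrete_instances.
Variables (H : finType) (h0 : H).

HB.instance Definition _ := Finite.copy (discrete h0) H.
HB.instance Definition _ := isPointed.Build (discrete h0) h0.
HB.instance Definition _ := @isMeasurable.Build default_measure_display
  (discrete h0) discrete_measurable discrete_measurable0
  discrete_measurableC discrete_measurableU.

End discrete_instances.

Section product_distribution.
Context {d : measure_display} {T : measurableType d} {R : realType}.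

Definition tuple_cons (n : nat) (p : T * n.-tuple T) : n.+1.-tuple T :=
  [tuple of p.1 :: p.2].

Lemma measurable_tuple_cons (n : nat) :
  measurable_fun [set: T * n.-tuple T] (@tuple_cons n).
Proof. by apply: measurable_cons. Qed.

HB.instance Definition _ (n : nat) :=
  isMeasurableFun.Build _ _ _ _ (@tuple_cons n) (@measurable_tuple_cons n).

(* P^n, with P^0 the point mass at the empty tuple and P^(n+1) the image of
   P \x P^n under (x, t) |-> x :: t. *)
Fixpoint iid (P : probability T R) (n : nat) : probability (n.-tuple T) R :=
  match n return probability (n.-tuple T) R with
  | 0 => @dirac _ (0.-tuple T) [tuple] R
  | n'.+1 => distribution (P \x iid P n')%E (@tuple_cons n')
  end.

End product_distribution.

Definition user_neighbors (Z : Type) (n m : nat)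
    (x x' : n.-tuple (m.-tuple Z)) : Prop :=
  exists i : 'I_n, forall j : 'I_n, j != i -> tnth x j = tnth x' j.

Definition user_level_DP (R : realType) (d dY : measure_display)
    (Z : measurableType d) (Y : measurableType dY) (n m : nat) (eps : R)
    (A : R.-pker (n.-tuple (m.-tuple Z)) ~> Y) : Prop :=
  forall x x' : n.-tuple (m.-tuple Z), user_neighbors x x' ->
  forall S : set Y, measurable S -> (A x S <= (expR eps)%:E * A x' S)%E.

Section scores.
Context (R : realType) (d : measure_display) (Z : measurableType d).
Context (H : finType) (psi : H -> H -> Z -> R) (D : probability Z R).

Definition pscore (h h' : H) : \bar R := ('E_D[psi h h'])%E.

(* The maximum of the empty family (when H is a singleton) is -oo. *)
Definition score (h : H) : \bar R :=
  (\big[maxe/-oo]_(h' : H | h' != h) pscore h h')%E.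

End scores.

(* f is Theta-tilde of g on dom: f and g agree up to a constant factor times a
   power of log g; 1 + |ln g| is used so that this factor is never below 1. *)
Definition is_Theta_tilde (R : realType) (P : Type) (dom : set P)
    (f g : P -> R) : Prop :=
  exists (c C : R) (k : nat), [/\ 0 < c, 0 < C &
    forall p, dom p ->
      c * (g p / (1 + `|ln (g p)|) ^+ k) <= f p
        <= C * (g p * (1 + `|ln (g p)|) ^+ k)].

Record selection_params (R : realType) := SelectionParams {
  sp_eps : R;
  sp_alpha : R;
  sp_beta : R;
  sp_card : nat; (* number of candidates *)
  sp_m : nat     (* examples per user *)
}.

Definition admissible (R : realType) (p : selection_params R) : Prop :=
  [/\ 0 < sp_eps p <= 2^-1, 0 < sp_alpha p <= 2^-1, 0 < sp_beta p <= 2^-1,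
      (0 < sp_card p)%N & (0 < sp_m p)%N].

Definition selection_rate (R : realType) (p : selection_params R) : R :=
  let L := ln ((sp_card p)%:R / sp_beta p) in
  L / sp_eps p
  + L / (sp_alpha p * sp_eps p * Num.sqrt (sp_m p)%:R)
  + L / (sp_alpha p ^+ 2 * (sp_m p)%:R).

(* Main.v *)
Require Import Defs.
From HB Require Import structures.
From mathcomp Require Import all_boot all_order all_algebra.
From mathcomp Require Import all_classical all_reals all_analysis.
From mathcomp Require Import measurable_realfun ring lra.

Set Implicit Arguments.
Unset Strict Implicit.
Unset Printing Implicit Defensive.

Import Order.TTheory GRing.Theory Num.Theory.
Import numFieldNormedType.Exports.

Local Open Scope classical_set_scope.
Local Open Scope ring_scope.

(** The mechanism averages, for each user and each pair (h, h'), the comparison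
    over the user's m examples, recentres it at 3 alpha / 10 and clips it to
    [-tau, tau] with tau of order alpha + log / sqrt m.  Clipping moves the
    expectation by at most alpha / 10, so its sign still tells scores below
    alpha / 10 from scores above alpha / 2.  Writing S(h, h') for the sum over
    the users, candidate h is drawn with probability proportional to
    (\sum_h' exp (lam S(h, h')))^-1.  One user changes each S(h, h') by at most
    2 tau, which gives privacy when 4 lam tau <= eps.  The probability of a bad
    h, whose score is large because of g, is at most
    \sum_h' exp (lam (S(h*, h') - S(h, g))).  The expectation of each term is an
    n-th power by independence, and the negative drift makes it at most
    exp (- lam alpha n / 10) as soon as lam is below a constant times
    alpha / tau^2; no union bound over events and no concentration inequality
    is needed. *)

(** * Integrals of bounded functions under a probability measure *)

Section bounded_integrals.
Context {d : measure_display} {T : measurableType d} {R : realType}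
  (P : probability T R).
Implicit Types f g : T -> R.

Lemma probability_bounded_integrable f (M : R) :
  measurable_fun [set: T] f -> (forall x, `|f x| <= M) ->
  P.-integrable [set: T] (EFin \o f).
Proof.
move=> mf fM; apply: measurable_bounded_integrable => //.
  by rewrite -ge0_fin_numE// fin_num_measure.
by exists M; split; [exact: num_real|move=> y My x _; exact: (le_trans _ (ltW My))].
Qed.

Lemma EFin_Rintegral f : P.-integrable [set: T] (EFin \o f) ->
  (\int[P]_x (f x)%:E)%E = (\int[P]_x f x)%:E.
Proof. by move=> intf; rewrite /Rintegral fineK//; exact: integrable_fin_num. Qed.

Lemma integral_probability_cst (r : R) : (\int[P]_x r%:E = r%:E)%E.
Proof.
rewrite (integral_cst P measurableT r%:E) -[RHS]mule1; congr (_ * _)%E.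
exact: probability_setT.
Qed.

Lemma Rintegral_probability_cst (r : R) : \int[P]_x r = r.
Proof. by rewrite /Rintegral integral_probability_cst. Qed.

Lemma probability_integrable_cst (r : R) :
  P.-integrable [set: T] (EFin \o cst r).
Proof. by apply: (@probability_bounded_integrable _ `|r|) => //. Qed.

Lemma Rintegral_probabilityDr f (r : R) : P.-integrable [set: T] (EFin \o f) ->
  \int[P]_x (f x + r) = \int[P]_x f x + r.
Proof.
move=> intf; rewrite RintegralD ?Rintegral_probability_cst//.
exact: probability_integrable_cst.
Qed.

Lemma Rintegral_le_pointwise f g :
  P.-integrable [set: T] (EFin \o f) -> P.-integrable [set: T] (EFin \o g) ->
  (forall x, f x <= g x) -> \int[P]_x f x <= \int[P]_x g x.
Proof. by move=> intf intg fg; exact: le_Rintegral. Qed.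

End bounded_integrals.

(** * Products and sums over an i.i.d. sample *)

Section iid_integrals.
Context {d : measure_display} {T : measurableType d} {R : realType}
  (P : probability T R).

Lemma ge0_integral_iidS (n : nat) (f : n.+1.-tuple T -> \bar R) :
  measurable_fun [set: n.+1.-tuple T] f -> (forall t, 0 <= f t)%E ->
  (\int[iid P n.+1]_t f t =
   \int[P]_x \int[iid P n]_t f [tuple of x :: t])%E.
Proof.
move=> mf f0 /=.
rewrite ge0_integral_distribution// fubini_tonelli1//; last first.
  by move=> x; exact: f0.
by apply: measurableT_comp => //; exact: measurable_tuple_cons.
Qed.

Lemma integral_iid0 (f : 0.-tuple T -> \bar R) :
  measurable_fun [set: 0.-tuple T] f -> (\int[iid P 0]_t f t = f [tuple])%E.
Proof. by move=> mf; rewrite /= integral_dirac// diracT mul1e. Qed.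

Lemma measurable_tuple_sum (n : nat) (f : T -> R) :
  measurable_fun [set: T] f ->
  measurable_fun [set: n.-tuple T] (fun t => \sum_(i < n) f (tnth t i)).
Proof.
move=> mf; apply: measurable_sum => i.
by apply: (measurableT_comp mf); exact: measurable_tnth.
Qed.

Lemma measurable_tuple_prod (n : nat) (f : T -> R) :
  measurable_fun [set: T] f ->
  measurable_fun [set: n.-tuple T] (fun t => \prod_(i < n) f (tnth t i)).
Proof.
move=> mf; apply: measurable_prod => i _.
by apply: (measurableT_comp mf); exact: measurable_tnth.
Qed.

(** This is how independence enters: Tonelli peels off the first coordinate, and the remaining
    factors are bounded by induction. Nonnegativity lets a one-sided bound on each factor pass to
    the product. *)
Lemma integral_iid_prod_le (n : nat) (f : T -> R) (r : R) :
  measurable_fun [set: T] f -> (forall x, 0 <= f x) ->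
  (\int[P]_x (f x)%:E <= r%:E)%E ->
  (\int[iid P n]_t (\prod_(i < n) f (tnth t i))%:E <= (r ^+ n)%:E)%E.
Proof.
move=> mf f0 fr.
have r0 : 0 <= r.
  by rewrite -lee_fin (le_trans _ fr)// integral_ge0// => x _; rewrite lee_fin.
elim: n => [|n ih].
  rewrite integral_iid0 ?big_ord0 ?expr0//.
  by apply/measurable_EFinP; exact: measurable_tuple_prod.
rewrite ge0_integral_iidS; last by move=> t; rewrite lee_fin; apply: prodr_ge0.
  2: by apply/measurable_EFinP; exact: measurable_tuple_prod.
apply: (@le_trans _ _ (\int[P]_x ((r ^+ n)%:E * (f x)%:E))%E); last first.
{ rewrite ge0_integralZl//.
  - by rewrite exprSr EFinM lee_wpmul2l// lee_fin exprn_ge0.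
  - exact/measurable_EFinP.
  - by move=> x _; rewrite lee_fin.
  - by rewrite lee_fin exprn_ge0. }
(* For a fixed first coordinate [x], the factor [f x] is constant in the inner integral. *)
have intE x : (\int[iid P n]_t (\prod_(i < n.+1) f (tnth [tuple of x :: t] i))%:E =
    (f x)%:E * \int[iid P n]_t (\prod_(i < n) f (tnth t i))%:E)%E.
  rewrite -ge0_integralZl//.
  - apply: eq_integral => t _; rewrite big_ord_recl -EFinM; congr (_ * _)%:E.
    by apply: eq_bigr => i _; rewrite tnthS.
  - by apply/measurable_EFinP; exact: measurable_tuple_prod.
  - by move=> t _; rewrite lee_fin; apply: prodr_ge0.
  - by rewrite lee_fin.
rewrite (eq_integral _ _ (fun x _ => intE x)).
apply: ge0_le_integral => //.
- move=> x _; rewrite mule_ge0 ?lee_fin// integral_ge0// => t _.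
  by rewrite lee_fin; apply: prodr_ge0.
- by apply: emeasurable_funM => //; exact/measurable_EFinP.
- by apply: emeasurable_funM => //; exact/measurable_EFinP.
- by move=> x _; rewrite muleC lee_wpmul2r// lee_fin.
Qed.

Lemma integral_iid_sum (n : nat) (f : T -> R) (r : R) :
  measurable_fun [set: T] f -> (forall x, 0 <= f x) ->
  (\int[P]_x (f x)%:E = r%:E)%E ->
  (\int[iid P n]_t (\sum_(i < n) f (tnth t i))%:E = (n%:R * r)%:E)%E.
Proof.
move=> mf f0 fr.
elim: n => [|n ih].
  rewrite integral_iid0 ?big_ord0 ?mul0r//.
  by apply/measurable_EFinP; exact: measurable_tuple_sum.
rewrite ge0_integral_iidS; last by move=> t; rewrite lee_fin; apply: sumr_ge0.
  2: by apply/measurable_EFinP; exact: measurable_tuple_sum.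
have intE x : (\int[iid P n]_t (\sum_(i < n.+1) f (tnth [tuple of x :: t] i))%:E =
    (f x)%:E + (n%:R * r)%:E)%E.
  rewrite -ih -[X in (X + _)%E](integral_probability_cst (iid P n)).
  rewrite -ge0_integralD//.
  - apply: eq_integral => t _; rewrite big_ord_recl EFinD; congr (_ + _)%E.
    by congr EFin; apply: eq_bigr => i _; rewrite tnthS.
  - by move=> t _; rewrite lee_fin.
  - by move=> t _; rewrite lee_fin; apply: sumr_ge0.
  - by apply/measurable_EFinP; exact: measurable_tuple_sum.
have r0 : 0 <= r.
  by rewrite -lee_fin -fr integral_ge0// => x _; rewrite lee_fin.
rewrite (eq_integral _ _ (fun x _ => intE x)).
rewrite ge0_integralD//.
- rewrite fr integral_probability_cst -EFinD.
  by rewrite -natr1 mulrDl mul1r addrC.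
- by move=> x _; rewrite lee_fin.
- exact/measurable_EFinP.
- by move=> x _; rewrite lee_fin mulr_ge0.
Qed.

Lemma Rintegral_iid_sum (n : nat) (f : T -> R) (M : R) :
  measurable_fun [set: T] f -> (forall x, `|f x| <= M) ->
  \int[iid P n]_t (\sum_(i < n) f (tnth t i)) = n%:R * \int[P]_x f x.
Proof.
move=> mf fM.
have intf := probability_bounded_integrable P mf fM.
(* Shifting by [M] makes the function nonnegative, so that [integral_iid_sum] applies; the total
   shift [n%:R * M] is subtracted afterwards. *)
have mg : measurable_fun [set: T] (fun x => f x + M) by exact: measurable_funD.
have g0 x : 0 <= f x + M by have := fM x; rewrite ler_norml; lra.
have := @integral_iid_sum n _ (\int[P]_x f x + M) mg g0.
rewrite -Rintegral_probabilityDr// EFin_Rintegral; last first.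
  apply: (@probability_bounded_integrable _ _ _ _ _ (M + M)) => // x.
  by have := fM x; rewrite !ler_norml; lra.
move=> /(_ erefl) gE.
have -> : \int[iid P n]_t (\sum_(i < n) f (tnth t i)) =
  \int[iid P n]_t (\sum_(i < n) (f (tnth t i) + M) + - (n%:R * M)).
  apply: eq_Rintegral => t _; rewrite big_split/= sumr_const card_ord.
  by rewrite mulr_natl addrK.
rewrite Rintegral_probabilityDr.
  rewrite /Rintegral gE/= -/(Rintegral P setT _) Rintegral_probabilityDr//.
  by rewrite -/(Rintegral P setT _); ring.
apply: (@probability_bounded_integrable _ _ _ _ _ (n%:R * (M + M))).
  exact: (@measurable_tuple_sum _ (fun x => f x + M)).
move=> t; rewrite (le_trans (ler_norm_sum _ _ _))// mulr_natl.
rewrite -[X in _ *+ X](card_ord n) -sumr_const ler_sum// => i _.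
by have := fM (tnth t i); rewrite !ler_norml; lra.
Qed.

End iid_integrals.

(** * Exponential moments of bounded variables *)

Section exponential_moments.
Context {d : measure_display} {T : measurableType d} {R : realType}.

(** Multiplying by [1 - x <= expR (- x)] leaves a polynomial inequality whose slack
    [x ^+ 2 * (1 - 2 * x)] is nonnegative for [x <= 1/2], negative [x] included. *)
Lemma expR_le_quadratic (x : R) : x <= 2^-1 -> expR x <= 1 + x + 2 * x ^+ 2.
Proof.
move=> x12; have x1 : 0 < 1 - x by lra.
rewrite -(ler_pM2r x1) (@le_trans _ _ (expR x * expR (- x)))//.
  by rewrite ler_wpM2l ?expR_ge0//; exact: expR_ge1Dx.
rewrite expRxMexpNx_1 -subr_ge0.
have -> : (1 + x + 2 * x ^+ 2) * (1 - x) - 1 = x ^+ 2 * (1 - 2 * x) by ring.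
by rewrite mulr_ge0 ?sqr_ge0//; lra.
Qed.

Lemma ge0_integrable_le (P : probability T R) (f : T -> R) (r : R) :
  measurable_fun [set: T] f -> (forall x, 0 <= f x) ->
  (\int[P]_x (f x)%:E <= r%:E)%E ->
  P.-integrable [set: T] (EFin \o f) /\ \int[P]_x f x <= r.
Proof.
move=> mf f0 fr.
have intf : P.-integrable [set: T] (EFin \o f).
  apply/integrableP; split; first exact/measurable_EFinP.
  under eq_integral do rewrite /= ger0_norm//.
  by rewrite (le_lt_trans fr)// ltry.
by split => //; rewrite -lee_fin -EFin_Rintegral.
Qed.

Lemma integrable_addr (P : probability T R) (f g : T -> R) :
  P.-integrable [set: T] (EFin \o f) -> P.-integrable [set: T] (EFin \o g) ->
  P.-integrable [set: T] (EFin \o (fun x => f x + g x)).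
Proof. by move=> intf intg; exact: (integrableD measurableT intf intg). Qed.

Lemma integrable_mulr (P : probability T R) (f : T -> R) (k : R) :
  P.-integrable [set: T] (EFin \o f) ->
  P.-integrable [set: T] (EFin \o (fun x => k * f x)).
Proof. by move=> intf; exact: (integrableZl measurableT k intf). Qed.

(** Integrates [expR_le_quadratic] after bounding [f x ^+ 2] by [B ^+ 2]. The mean enters linearly,
    so a negative drift survives as long as [B ^+ 2] is small compared with it. *)
Lemma integral_expR_le (P : probability T R) (f : T -> R) (a B : R) :
  measurable_fun [set: T] f -> (forall x, `|f x| <= B) -> B <= 2^-1 ->
  \int[P]_x f x <= a ->
  (\int[P]_x (expR (f x))%:E <= (1 + a + 2 * B ^+ 2)%:E)%E.
Proof.
move=> mf fB B12 fa.
have intf := probability_bounded_integrable P mf fB.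
have f12 x : f x <= 2^-1 by have := fB x; rewrite ler_norml; lra.
have f2 x : f x ^+ 2 <= B ^+ 2.
  by rewrite -real_normK ?num_real// lerXn2r ?nnegrE// (le_trans _ (fB x)).
apply: (@le_trans _ _ (\int[P]_x (f x + (1 + 2 * B ^+ 2)))%:E); last first.
  by rewrite lee_fin Rintegral_probabilityDr//; lra.
rewrite -EFin_Rintegral; last first.
  apply: (@probability_bounded_integrable _ _ _ _ _ (B + (1 + 2 * B ^+ 2))).
    exact: measurable_funD.
  move=> x; rewrite (le_trans (ler_normD _ _))// lerD// ger0_norm//.
  by have := sqr_ge0 B; lra.
apply: ge0_le_integral => //=.
- by apply/measurable_EFinP; apply: measurableT_comp.
- by apply/measurable_EFinP; exact: measurable_funD.
- move=> x _; rewrite lee_fin (le_trans (expR_le_quadratic (f12 x)))//.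
  by have := f2 x; lra.
Qed.

Lemma RintegralN (P : probability T R) (f : T -> R) :
  P.-integrable [set: T] (EFin \o f) -> \int[P]_x (- f x) = - \int[P]_x f x.
Proof.
move=> intf; rewrite -mulN1r -RintegralZl//.
by apply: eq_Rintegral => x _; rewrite mulN1r.
Qed.

End exponential_moments.

(** * Clipped means and their bias *)

Definition clip (R : realType) (tau x : R) : R := Num.max (- tau) (Num.min x tau).

Definition tuple_mean (R : realType) (T : Type) (m : nat) (f : T -> R)
    (t : m.-tuple T) : R :=
  (\sum_(i < m) f (tnth t i)) / m%:R.

(* The margin added to delta keeps the clipping bias of the mean of m samples
   below delta / 2. *)
Definition clip_level (R : realType) (delta : R) (m : nat) : R :=
  delta + 8 / Num.sqrt m%:R * (1 + ln (1 + 16 / (delta * Num.sqrt m%:R))).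

Section clipped_mean.
Context {d : measure_display} {T : measurableType d} {R : realType}.

Lemma clipN (tau x : R) : 0 <= tau -> clip tau (- x) = - clip tau x.
Proof.
move=> tau0; rewrite /clip /Num.min /Num.max.
by case: (ltP (- x) tau) => ?; case: (ltP x tau) => ?; repeat case: ltP => ?; lra.
Qed.

Lemma normr_clip (tau x : R) : 0 <= tau -> `|clip tau x| <= tau.
Proof.
move=> tau0; rewrite ler_norml /clip /Num.min /Num.max.
by case: (ltP x tau) => ?; case: ltP => ?; lra.
Qed.

Lemma measurable_clip (tau : R) : measurable_fun [set: R] (clip tau).
Proof. by apply: measurable_maxr => //; exact: measurable_minr. Qed.

Lemma measurable_tuple_mean (m : nat) (f : T -> R) :
  measurable_fun [set: T] f -> measurable_fun [set: m.-tuple T] (tuple_mean f).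
Proof.
by move=> mf; apply: measurable_funM => //; exact: measurable_tuple_sum.
Qed.

Lemma tuple_meanN (m : nat) (f : T -> R) (t : m.-tuple T) :
  tuple_mean (fun x => - f x) t = - tuple_mean f t.
Proof. by rewrite /tuple_mean sumrN mulNr. Qed.

Lemma normr_tuple_mean (m : nat) (f : T -> R) (M : R) (t : m.-tuple T) :
  (0 < m)%N -> (forall x, `|f x| <= M) -> `|tuple_mean f t| <= M.
Proof.
move=> m0 fM; rewrite normrM normfV normr_nat ler_pdivrMr ?ltr0n//.
rewrite (le_trans (ler_norm_sum _ _ _))// mulr_natr.
by rewrite -[X in _ *+ X](card_ord m) -sumr_const ler_sum.
Qed.

Lemma Rintegral_tuple_mean (P : probability T R) (m : nat) (f : T -> R) (M : R) :
  (0 < m)%N -> measurable_fun [set: T] f -> (forall x, `|f x| <= M) ->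
  \int[iid P m]_t tuple_mean f t = \int[P]_x f x.
Proof.
move=> m0 mf fM; rewrite RintegralZr//.
  by rewrite (Rintegral_iid_sum _ _ mf fM) mulrC mulKf// pnatr_eq0 -lt0n.
apply: (@probability_bounded_integrable _ _ _ _ _ (m%:R * M)).
  exact: measurable_tuple_sum.
move=> t; rewrite (le_trans (ler_norm_sum _ _ _))// mulr_natl.
by rewrite -[X in _ *+ X](card_ord m) -sumr_const ler_sum.
Qed.

Lemma clip_level_ge (delta : R) (m : nat) : 0 < delta ->
  delta <= clip_level delta m.
Proof.
move=> d0; rewrite lerDl mulr_ge0// ?divr_ge0//.
by rewrite addr_ge0// ln_ge0// lerDl divr_ge0// mulr_ge0// ltW.
Qed.

(** Only the lower truncation can raise a value, and the overshoot [- tau - y] is dominated by an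
    exponential because [u <= expR u]. Integrating the bound then needs only an exponential moment.
    The slack between [x] and [y] allows a mean to be moved up to a prescribed value. *)
Lemma clip_le_expR (tau k x y : R) : 0 < k -> x <= y ->
  clip tau x <= y + k^-1 * expR (k * (- tau - y)).
Proof.
move=> k0 xy; rewrite /clip ge_max ge_min; apply/andP; split; last first.
  apply/orP; left; apply: (le_trans xy).
  by rewrite lerDl mulr_ge0 ?expR_ge0// invr_ge0 ltW.
have : k * (- tau - y) <= expR (k * (- tau - y)).
  by rewrite (le_trans _ (expR_ge1Dx _))//; lra.
by rewrite -ler_pdivlMl//; lra.
Qed.

(** With [s = sqrt m], each sample contributes the exponent [f / (8 s)], of absolute value at most
    [1 / (2 s) <= 1/2]. Each factor then has expectation at most [1 + 1 / (2 m) <= expR (1 / m)],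
    and the [m]-th power is at most [expR 1]. *)
Lemma integral_expR_mean_le (P : probability T R) (m : nat) (f : T -> R) :
  (0 < m)%N -> measurable_fun [set: T] f -> (forall x, `|f x| <= 4) ->
  \int[P]_x f x = 0 ->
  (\int[iid P m]_t (expR (Num.sqrt m%:R / 8 * tuple_mean f t))%:E
    <= (expR 1)%:E)%E.
Proof.
move=> m0 mf f4 f0; set s := Num.sqrt _.
have m1 : 1 <= m%:R :> R by rewrite ler1n.
have s1 : 1 <= s by rewrite -sqrtr1 ler_sqrt// ltr0n.
have s2 : s ^+ 2 = m%:R by rewrite sqr_sqrtr.
have sm : s / m%:R = s^-1 by rewrite -s2 expr2 invfM mulrA divff ?mul1r// gt_eqF//; lra.
have B12 : s^-1 / 2 <= 2^-1.
  by rewrite ler_pdivrMr// mulVf// invf_le1//; lra.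
have fB x : `|(8 * s)^-1 * f x| <= s^-1 / 2.
  rewrite normrM gtr0_norm ?invr_gt0; last lra.
  rewrite invfM -mulrA mulrCA ler_wpM2l ?invr_ge0//; first lra.
  by have := f4 x; lra.
have mg : measurable_fun [set: T] (fun x => (8 * s)^-1 * f x).
  exact: measurable_funM.
have fint : P.-integrable [set: T] (EFin \o f).
  exact: probability_bounded_integrable mf f4.
have := integral_expR_le mg fB B12 (a := 0) (P := P).
rewrite RintegralZl// f0 mulr0 => /(_ (lexx _)).
move=> /(integral_iid_prod_le m).
move=> /(_ (measurableT_comp (@measurable_expR R) mg)).
move=> /(_ (fun x => expR_ge0 _)) H.
rewrite (eq_integral (fun t =>
  (\prod_(i < m) expR ((8 * s)^-1 * f (tnth t i)))%:E)); last first.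
  move=> t _; rewrite -expR_sum -mulr_sumr /tuple_mean; congr (expR _)%:E.
  by rewrite invfM -sm; ring.
apply: (le_trans H); rewrite lee_fin -[X in _ <= expR X](@mulfV _ m%:R) ?gt_eqF//; last lra.
rewrite expRM_natl lerXn2r ?nnegrE ?expR_ge0//.
  by have := sqr_ge0 (s^-1 / 2); lra.
rewrite (le_trans _ (expR_ge1Dx _))// expr_div_n exprVn s2.
have : 0 <= m%:R^-1 :> R by rewrite invr_ge0.
by lra.
Qed.

(** The sample mean is first shifted up to have expectation exactly [- delta]. Clipping then costs
    at most [c] times an exponential moment of the centred mean, and [clip_level] is calibrated to
    make this cost at most [delta / 2]. *)
Lemma clipped_mean_le (P : probability T R) (m : nat) (f : T -> R) (delta : R) :
  (0 < m)%N -> measurable_fun [set: T] f -> (forall x, `|f x| <= 2) ->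
  0 < delta -> \int[P]_x f x <= - delta ->
  \int[iid P m]_t clip (clip_level delta m) (tuple_mean f t) <= - (delta / 2).
Proof.
move=> m0 mf f2 d0 fd; set tau := clip_level _ _; set mu := \int[P]_x f x in fd.
have tau0 : 0 <= tau by rewrite (le_trans (ltW d0))// clip_level_ge.
have m1 : 1 <= m%:R :> R by rewrite ler1n.
set s := Num.sqrt m%:R : R.
have s0 : 0 < s by rewrite sqrtr_gt0; lra.
have k0 : 0 < s / 8 by lra.
have intf := probability_bounded_integrable P mf f2.
(* This yields the bound [4] on [mu - f] that [integral_expR_mean_le] asks for. *)
have mu2 : `|mu| <= 2.
  rewrite (le_trans (le_normr_Rintegral _ _))//.
  rewrite -[leRHS](Rintegral_probability_cst P) Rintegral_le_pointwise//.
  - apply: (@probability_bounded_integrable _ _ _ _ _ 2) => [|x].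
      exact: measurableT_comp.
    by rewrite normr_id.
  - exact: probability_integrable_cst.
have mg : measurable_fun [set: T] (fun x => mu - f x) by exact: measurable_funB.
have g4 x : `|mu - f x| <= 4.
  by rewrite (le_trans (ler_normB _ _))//; have := f2 x; lra.
have g0 : \int[P]_x (mu - f x) = 0.
  rewrite RintegralB ?Rintegral_probability_cst ?subrr//.
  exact: probability_integrable_cst.
have mh : measurable_fun [set: m.-tuple T]
    (fun t => expR (s / 8 * tuple_mean (fun x => mu - f x) t)).
  by do 2 apply: measurableT_comp => //; exact: measurable_tuple_mean.
have [inth hle] := ge0_integrable_le mh (fun t => expR_ge0 _)
  (integral_expR_mean_le m0 mg g4 g0).
set h := (fun t => expR _) in mh inth hle.
have meanE (t : m.-tuple T) : tuple_mean (fun x => mu - f x) t = mu - tuple_mean f t.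
  rewrite /tuple_mean big_split/= sumrN sumr_const card_ord mulrBl.
  by rewrite -[X in X / _ - _]mulr_natr mulfK// gt_eqF//; lra.
(* Taking [y = tuple_mean f t - mu - delta] and [k = s / 8] in [clip_le_expR], the exponent splits
   into the centred mean, which gives [h], and the constant [delta - tau], which gives [c]. *)
set c := (s / 8)^-1 * expR (s / 8 * (delta - tau)).
have c0 : 0 <= c by rewrite mulr_ge0 ?expR_ge0// invr_ge0 ltW.
have intmean : (iid P m).-integrable [set: m.-tuple T] (EFin \o tuple_mean f).
  apply: (@probability_bounded_integrable _ _ _ _ _ 2).
    exact: measurable_tuple_mean.
  by move=> t; exact: normr_tuple_mean.
have intmeanD : (iid P m).-integrable [set: m.-tuple T]
    (EFin \o (fun t => tuple_mean f t + (- mu - delta))).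
  by apply: integrable_addr => //; exact: probability_integrable_cst.
have intch : (iid P m).-integrable [set: m.-tuple T] (EFin \o (fun t => c * h t)).
  exact: integrable_mulr.
apply: (@le_trans _ _
    (\int[iid P m]_t ((tuple_mean f t + (- mu - delta)) + c * h t))).
  apply: Rintegral_le_pointwise.
  - apply: (@probability_bounded_integrable _ _ _ _ _ tau).
      apply: measurableT_comp; first exact: measurable_clip.
      exact: measurable_tuple_mean.
    by move=> t; exact: normr_clip.
  - exact: integrable_addr.
  - move=> t.
    have xy : tuple_mean f t <= tuple_mean f t + (- mu - delta) by lra.
    rewrite (le_trans (clip_le_expR tau k0 xy))// lerD2l /c -[leRHS]mulrA.
    rewrite ler_wpM2l ?invr_ge0 ?(ltW k0)// -expRD ler_expR meanE.
    by rewrite -mulrDr ler_wpM2l ?(ltW k0)//; lra.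
rewrite RintegralD// Rintegral_probabilityDr// RintegralZl//.
rewrite (Rintegral_tuple_mean _ m0 mf f2) -/mu.
suff : c * \int[iid P m]_t h t <= delta / 2 by lra.
apply: (@le_trans _ _ (c * expR 1)); first by rewrite ler_wpM2l.
rewrite /c -[leLHS]mulrA -expRD.
have ds : 0 < delta * s by rewrite mulr_gt0.
(* The summand [1] of [clip_level] cancels the factor [expR 1] of the moment bound, and its
   logarithm leaves [8 / (s + 16 / delta)], which is at most [delta / 2]. *)
have -> : s / 8 * (delta - tau) + 1 = - ln (1 + 16 / (delta * s)).
  by rewrite /tau /clip_level -/s; field; rewrite gt_eqF//=; lra.
rewrite expRN lnK ?posrE; last by rewrite addr_gt0// divr_gt0.
rewrite -invfM invf_ple ?posrE//; [|by rewrite mulr_gt0// addr_gt0// divr_gt0|by lra].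
have -> : (s / 8) * (1 + 16 / (delta * s)) = s / 8 + (delta / 2)^-1.
  by field; rewrite !gt_eqF.
by lra.
Qed.

(** Clipping is odd, so [clipped_mean_le] for [- f] gives the claim. *)
Lemma clipped_mean_ge (P : probability T R) (m : nat) (f : T -> R) (delta : R) :
  (0 < m)%N -> measurable_fun [set: T] f -> (forall x, `|f x| <= 2) ->
  0 < delta -> delta <= \int[P]_x f x ->
  delta / 2 <= \int[iid P m]_t clip (clip_level delta m) (tuple_mean f t).
Proof.
move=> m0 mf f2 d0 fd.
have tau0 : 0 <= clip_level delta m by rewrite (le_trans (ltW d0))// clip_level_ge.
have mNf : measurable_fun [set: T] (fun x => - f x) by exact: measurableT_comp.
have Nf2 x : `|- f x| <= 2 by rewrite normrN.
have := @clipped_mean_le P m _ delta m0 mNf Nf2 d0.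
rewrite RintegralN; last exact: probability_bounded_integrable mf f2.
rewrite lerN2 => /(_ fd).
rewrite (@eq_Rintegral _ _ _ _ _
  (fun t => - clip (clip_level delta m) (tuple_mean f t))).
  rewrite RintegralN ?lerN2//.
  apply: (@probability_bounded_integrable _ _ _ _ _ (clip_level delta m)).
    apply: measurableT_comp; first exact: measurable_clip.
    exact: measurable_tuple_mean.
  by move=> t; exact: normr_clip.
by move=> t _; rewrite tuple_meanN clipN.
Qed.

End clipped_mean.

(** * Probability kernels into a finite type *)

Section finite_kernel.
Context {d : measure_display} {X : measurableType d} {R : realType}.
Context (H : finType) (h0 : H) (p : X -> H -> R).
Hypothesis measurable_p : forall h, measurable_fun [set: X] (p ^~ h).
Hypothesis p_ge0 : forall x h, 0 <= p x h.
Hypothesis sum_p : forall x, \sum_h p x h = 1.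

(** A mixture of Dirac masses along the enumeration of [H]: as a [msum] of scaled measures it is a
    measure by construction. *)
Definition finite_kernel (x : X) : {measure set (discrete h0) -> \bar R} :=
  msum (fun k => mscale (NngNum (p_ge0 x (nth h0 (enum H) k)))
    (@dirac _ (discrete h0) (nth h0 (enum H) k) R)) #|H|.

Lemma finite_kernelE (x : X) (S : set (discrete h0)) :
  finite_kernel x S = (\sum_(h : H) p x h * \1_S (h : discrete h0))%:E.
Proof.
rewrite /finite_kernel /= /msum /mscale /= -sumEFin.
transitivity (\sum_(h in H) (p x h * \1_S (h : discrete h0))%:E)%E; last first.
  exact: eq_bigl.
rewrite [RHS]big_enum_val; apply: eq_bigr => k _.
by rewrite (enum_val_nth h0) EFinM.
Qed.

Lemma measurable_finite_kernel (S : set (discrete h0)) : measurable S ->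
  measurable_fun [set: X] (finite_kernel ^~ S).
Proof.
move=> _; under eq_fun do rewrite finite_kernelE.
apply/measurable_EFinP; apply: measurable_sum => h.
exact: measurable_funM.
Qed.

HB.instance Definition _ := isKernel.Build _ _ _ _ R finite_kernel
  measurable_finite_kernel.

Lemma finite_kernelT (x : X) : finite_kernel x [set: discrete h0] = 1%E.
Proof.
rewrite finite_kernelE; congr EFin; rewrite -(sum_p x).
by apply: eq_bigr => h _; rewrite indicT mulr1.
Qed.

HB.instance Definition _ := Kernel_isProbability.Build _ _ _ _ R finite_kernel
  finite_kernelT.

Lemma finite_pkerP : exists A : R.-pker X ~> discrete h0, forall x S,
  A x S = (\sum_(h : H) p x h * \1_S (h : discrete h0))%:E.
Proof. by exists finite_kernel; exact: finite_kernelE. Qed.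

End finite_kernel.

Lemma measurable_fun_invr_gt0 (R : realType) (d : measure_display)
    (X : measurableType d) (f : X -> R) : measurable_fun [set: X] f -> (forall x, 0 < f x) ->
  measurable_fun [set: X] (fun x => (f x)^-1).
Proof.
move=> mf f0; rewrite [X in measurable_fun _ X](_ : _ = fun x => f x `^ (-1)).
  by apply: (measurableT_comp (measurable_powR _)).
by apply/funext => x; rewrite powR_inv1// ltW.
Qed.

(** * The soft exponential mechanism: privacy and accuracy *)

Section soft_exponential_mechanism.
Context {d : measure_display} {T : measurableType d} {R : realType}.
Context (H : finType) (c : H -> H -> T -> R) (lam : R) (n : nat).
Implicit Types (h g : H) (x : n.-tuple T).

(** The logarithm is a log-sum-exp, a smooth substitute for [lam] times the maximum over [h'] of the
    summed comparisons. The exponentials are kept as products over users so that independence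
    applies directly. *)
Definition soft_score h x : R :=
  \sum_(h' : H) \prod_(i < n) expR (lam * c h h' (tnth x i)).

Definition soft_pmf x h : R :=
  (soft_score h x)^-1 / \sum_(g : H) (soft_score g x)^-1.

Lemma soft_score_ge h g x :
  \prod_(i < n) expR (lam * c h g (tnth x i)) <= soft_score h x.
Proof.
rewrite /soft_score (bigD1 g)//= lerDl sumr_ge0// => h' _.
by rewrite prodr_ge0// => i _; exact: expR_ge0.
Qed.

Lemma soft_score_gt0 h x : 0 < soft_score h x.
Proof.
rewrite (lt_le_trans _ (soft_score_ge h h x))// prodr_gt0// => i _.
exact: expR_gt0.
Qed.

Lemma sum_soft_scoreV_ge h x :
  (soft_score h x)^-1 <= \sum_(g : H) (soft_score g x)^-1.
Proof.
by rewrite (bigD1 h)//= lerDl sumr_ge0// => g _; rewrite invr_ge0 ltW// soft_score_gt0.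
Qed.

Lemma sum_soft_scoreV_gt0 h x : 0 < \sum_(g : H) (soft_score g x)^-1.
Proof. by rewrite (lt_le_trans _ (sum_soft_scoreV_ge h x))// invr_gt0 soft_score_gt0. Qed.

Lemma soft_pmf_ge0 x h : 0 <= soft_pmf x h.
Proof.
rewrite /soft_pmf divr_ge0 ?invr_ge0 ?(ltW (soft_score_gt0 _ _))//.
exact/ltW/(sum_soft_scoreV_gt0 h).
Qed.

Lemma sum_soft_pmf (h0 : H) x : \sum_h soft_pmf x h = 1.
Proof. by rewrite -mulr_suml divff// gt_eqF// (sum_soft_scoreV_gt0 h0). Qed.

Hypothesis measurable_c : forall h g, measurable_fun [set: T] (c h g).

Lemma measurable_soft_factor h g :
  measurable_fun [set: T] (fun t => expR (lam * c h g t)).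
Proof. by apply: measurableT_comp => //; exact: measurable_funM. Qed.

Lemma measurable_soft_score h : measurable_fun [set: n.-tuple T] (soft_score h).
Proof.
apply: measurable_sum => g.
exact: (measurable_tuple_prod (measurable_soft_factor h g)).
Qed.

Lemma measurable_soft_pmf h : measurable_fun [set: n.-tuple T] (soft_pmf ^~ h).
Proof.
have mV g : measurable_fun [set: n.-tuple T] (fun x => (soft_score g x)^-1).
  by apply: measurable_fun_invr_gt0; [exact: measurable_soft_score|exact: soft_score_gt0].
apply: measurable_funM => //.
apply: measurable_fun_invr_gt0; last exact: (sum_soft_scoreV_gt0 h).
exact: measurable_sum.
Qed.

Lemma measurable_sum_soft_pmf (B : pred H) :
  measurable_fun [set: n.-tuple T] (fun x => \sum_(h | B h) soft_pmf x h).
Proof.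
under eq_fun do rewrite big_mkcond.
by apply: measurable_sum => h; case: (B h) => //; exact: measurable_soft_pmf.
Qed.

(** One user occurs in a single factor of each product, which changes by at most
    [expR (2 * lam * tau)]. The weight of [h] and the normaliser each lose this factor once, hence
    the [4]. *)
Lemma soft_pmf_neighbor_le (tau : R) x x' (i : 'I_n) h :
  0 <= lam -> (forall h g t, `|c h g t| <= tau) ->
  (forall j, j != i -> tnth x j = tnth x' j) ->
  soft_pmf x h <= expR (4 * lam * tau) * soft_pmf x' h.
Proof.
move=> lam0 ctau xx'.
have score_le (y y' : n.-tuple T) g : (forall j, j != i -> tnth y j = tnth y' j) ->
    soft_score g y <= expR (2 * lam * tau) * soft_score g y'.
  move=> yy'; rewrite /soft_score mulr_sumr ler_sum// => h' _.
  rewrite (bigD1 i)//= [X in _ <= _ * X](bigD1 i)//= mulrA.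
  rewrite (eq_bigr (fun j => expR (lam * c g h' (tnth y' j)))); last first.
    by move=> j ji; rewrite yy'.
  rewrite ler_wpM2r ?prodr_ge0//.
  rewrite -expRD ler_expR.
  have := ctau g h' (tnth y i); have := ctau g h' (tnth y' i).
  rewrite !ler_norml => /andP[a1 a2] /andP[b1 b2].
  have : lam * (c g h' (tnth y i) - c g h' (tnth y' i)) <= lam * (tau + tau).
    by rewrite ler_wpM2l//; lra.
  by lra.
have x'x j : j != i -> tnth x' j = tnth x j by move=> ji; rewrite xx'.
have inv_le (y y' : n.-tuple T) g : (forall j, j != i -> tnth y j = tnth y' j) ->
    (soft_score g y)^-1 <= expR (2 * lam * tau) * (soft_score g y')^-1.
  move=> yy'; rewrite ler_pdivlMr ?soft_score_gt0// ler_pdivrMl ?soft_score_gt0//.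
  rewrite mulrC score_le// => j ji.
  by rewrite yy'.
have -> : expR (4 * lam * tau) = expR (2 * lam * tau) * expR (2 * lam * tau).
  by rewrite -expRD; congr expR; lra.
rewrite /soft_pmf mulrACA ler_pM ?invr_ge0 ?(ltW (soft_score_gt0 _ _))//.
- exact/ltW/(sum_soft_scoreV_gt0 h).
- exact: inv_le.
- rewrite ler_pdivlMr ?(sum_soft_scoreV_gt0 h)// ler_pdivrMl ?(sum_soft_scoreV_gt0 h)//.
  by rewrite mulrC mulr_sumr ler_sum// => g _; exact: inv_le.
Qed.

(** Keep a single term of each sum in the denominators: the normaliser is at least the inverse soft
    score of [hs], and the soft score of [h] is at least its term at [g]. *)
Lemma soft_pmf_le (hs h g : H) x :
  soft_pmf x h <=
  \sum_(h' : H) \prod_(i < n) expR (lam * (c hs h' (tnth x i) - c h g (tnth x i))).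
Proof.
have Zg0 : 0 < \prod_(i < n) expR (lam * c h g (tnth x i)).
  by rewrite prodr_gt0// => i _; exact: expR_gt0.
apply: (@le_trans _ _ (soft_score hs x / \prod_(i < n) expR (lam * c h g (tnth x i)))).
  rewrite /soft_pmf [leRHS]mulrC ler_pM ?invr_ge0 ?(ltW (soft_score_gt0 _ _))//.
  - exact/ltW/(sum_soft_scoreV_gt0 h).
  - by rewrite lef_pV2 ?posrE ?soft_score_gt0// soft_score_ge.
  - rewrite -[leRHS]invrK lef_pV2 ?posrE ?invr_gt0 ?soft_score_gt0//.
      exact: sum_soft_scoreV_ge.
    exact: sum_soft_scoreV_gt0.
rewrite mulr_suml ler_sum// => h' _; rewrite -prodfV -big_split/=.
by rewrite ler_prod// => i _; rewrite -expRN -expRD -mulrBr expR_ge0 lexx.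
Qed.

Lemma integral_soft_pmf_le (P : probability T R) (hs : H) (bad : pred H)
    (g : H -> H) (r : R) :
  (forall h h', bad h ->
    (\int[P]_t (expR (lam * (c hs h' t - c h (g h) t)))%:E <= r%:E)%E) ->
  0 <= r ->
  (\int[iid P n]_x (\sum_(h | bad h) soft_pmf x h)%:E
    <= (#|H|%:R ^+ 2 * r ^+ n)%:E)%E.
Proof.
move=> Pr r0.
(* Setting the terms of good candidates to [0] allows a sum over all pairs, whose number is the
   factor [#|H|%:R ^+ 2]. *)
pose F (q : H * H) x : R := if bad q.1 then
  \prod_(i < n) expR (lam * (c hs q.2 (tnth x i) - c q.1 (g q.1) (tnth x i))) else 0.
have mf h h' : measurable_fun [set: T] (fun t => expR (lam * (c hs h' t - c h (g h) t))).
  by apply: measurableT_comp => //; apply: measurable_funM => //; exact: measurable_funB.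
have mF q : measurable_fun [set: n.-tuple T] (F q).
  rewrite /F; case: (bad q.1) => //.
  exact: (measurable_tuple_prod (mf q.1 q.2)).
have F0 q x : 0 <= F q x.
  by rewrite /F; case: ifP => // _; rewrite prodr_ge0// => i _; exact: expR_ge0.
apply: (@le_trans _ _ (\int[iid P n]_x (\sum_(q : H * H) (F q x)%:E))%E).
  apply: ge0_le_integral => //=.
  - by move=> x _; rewrite lee_fin sumr_ge0// => h _; exact: soft_pmf_ge0.
  - by apply/measurable_EFinP; exact: measurable_sum_soft_pmf.
  - by apply: emeasurable_sum => q; exact/measurable_EFinP.
  - move=> x _; rewrite sumEFin lee_fin -(pair_bigA _ (fun h h' => F (h, h') x))/=.
    rewrite big_mkcond ler_sum// => h _; rewrite /F/=; case: ifP => _.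
      exact: soft_pmf_le.
    by rewrite sumr_ge0.
rewrite ge0_integral_sum//; last 2 first.
- by move=> q; exact/measurable_EFinP.
- by move=> q x _; rewrite lee_fin.
apply: (@le_trans _ _ (\sum_(q : H * H) (r ^+ n)%:E)%E).
  apply: lee_sum => q _; rewrite /F; have [bq|_] := boolP (bad q.1).
    exact: (integral_iid_prod_le n (mf q.1 q.2) (fun t => expR_ge0 _) (Pr _ _ bq)).
  by rewrite integral0 lee_fin exprn_ge0.
by rewrite sumEFin lee_fin sumr_const card_prod -[leLHS]mulr_natl natrM expr2.
Qed.

End soft_exponential_mechanism.

(** * Comparing the required sample size with the rate *)

Section sample_size.
Context {R : realType}.

Lemma ln_ge_half (x : R) : 2 <= x -> 2^-1 <= ln x.
Proof.
move=> x2; rewrite -ler_expR lnK ?posrE; last lra.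
by have := @expR_le_quadratic R 2^-1 (lexx _); rewrite expr2; lra.
Qed.

(** Here [q] is the sampling error [1 / sqrt m] of one user relative to [alpha]; the rate is [L]
    times a polynomial in [eps^-1] and [q]. *)
Lemma selection_rateE (eps alpha beta : R) (k m : nat) :
  0 < eps -> 0 < alpha -> (0 < m)%N ->
  let L := ln (k%:R / beta) in
  let q := (alpha * Num.sqrt m%:R)^-1 in
  selection_rate (SelectionParams eps alpha beta k m) =
  L * (eps^-1 + eps^-1 * q + q ^+ 2).
Proof.
move=> e0 a0 m0 L q; rewrite /selection_rate/= -/L /q.
have s0 : 0 < Num.sqrt m%:R :> R by rewrite sqrtr_gt0 ltr0n.
rewrite -[in X in _ + X = _](@sqr_sqrtr R m%:R)//.
by field; rewrite !gt_eqF.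
Qed.

(** [1 <= g] makes [ln g] nonnegative, and [q <= g] lets the logarithm in the clipping level be
    charged to [ln g]. Both rest on [L / eps >= 1], as [k / beta] and [eps^-1] are at least [2]. *)
Lemma selection_rate_bounds (eps alpha beta : R) (k m : nat) :
  0 < eps <= 2^-1 -> 0 < alpha <= 2^-1 -> 0 < beta <= 2^-1 ->
  (0 < k)%N -> (0 < m)%N ->
  let g := selection_rate (SelectionParams eps alpha beta k m) in
  [/\ 2^-1 <= ln (k%:R / beta), 1 <= g & (alpha * Num.sqrt m%:R)^-1 <= g].
Proof.
move=> /andP[e0 e12] /andP[a0 a12] /andP[b0 b12] k0 m0 /=.
rewrite selection_rateE//=; set L := ln _; set q := (alpha * _)^-1.
have q0 : 0 < q by rewrite invr_gt0 mulr_gt0// sqrtr_gt0 ltr0n.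
have k1 : 1 <= k%:R :> R by rewrite ler1n.
have L12 : 2^-1 <= L.
  apply: ln_ge_half; rewrite ler_pdivlMr//; lra.
have i2 : 2 <= eps^-1 by rewrite -[leLHS]invrK lef_pV2 ?posrE// invr_gt0.
have Li1 : 1 <= L * eps^-1.
  by rewrite -[leLHS](@mulVf _ 2)// ler_pM.
have q2 := sqr_ge0 q.
have Lq2 : 0 <= L * q ^+ 2 by rewrite mulr_ge0//; lra.
have Liq : q <= L * eps^-1 * q by rewrite ler_peMl// ltW.
split => //; nra.
Qed.

Lemma clip_level_ratio_le (eps alpha beta : R) (k m : nat) :
  0 < eps <= 2^-1 -> 0 < alpha <= 2^-1 -> 0 < beta <= 2^-1 ->
  (0 < k)%N -> (0 < m)%N ->
  clip_level (alpha / 5) m / alpha <= 1 + 656 * (alpha * Num.sqrt m%:R)^-1 *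
    (1 + `|ln (selection_rate (SelectionParams eps alpha beta k m))|).
Proof.
move=> he ha hb k0 m0; set g := selection_rate _.
have [_ g1 qg] := selection_rate_bounds he ha hb k0 m0.
rewrite -/g in g1 qg; case/andP: ha => a0 a12.
have s0 : 0 < Num.sqrt m%:R :> R by rewrite sqrtr_gt0 ltr0n.
set q := _^-1 in qg *.
have q0 : 0 < q by rewrite invr_gt0 mulr_gt0.
rewrite /clip_level.
have -> : 16 / (alpha / 5 * Num.sqrt m%:R) = 80 * q :> R.
  by rewrite /q; field; rewrite !gt_eqF.
have -> : (alpha / 5 + 8 / Num.sqrt m%:R * (1 + ln (1 + 80 * q))) / alpha =
    5^-1 + 8 * q * (1 + ln (1 + 80 * q)).
  by rewrite /q; field; rewrite !gt_eqF.
have lng : 0 <= ln g by exact: ln_ge0.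
rewrite ger0_norm//.
(* Since [ln 81 <= 81], the bracket [1 + ln (1 + 80 * q)] is at most [82 * (1 + ln g)]; with the
   factor [8] this gives [656]. *)
have ln_le : ln (1 + 80 * q) <= 81 + ln g.
  apply: (@le_trans _ _ (ln (81 * g))).
    by rewrite ler_ln ?posrE; lra.
  by rewrite lnM ?posrE; [rewrite lerD2r ltW// ln_sublinear|lra|lra].
have : q * (1 + ln (1 + 80 * q)) <= q * (82 * (1 + ln g)).
  by rewrite ler_pM2l//; lra.
by lra.
Qed.

(** The variables stand for [ln (k / beta)], [eps^-1], [(alpha * sqrt m)^-1], [1 + |ln g|], a
    constant, and [tau / alpha]. The ratio [u] carries one logarithmic factor and occurs squared,
    whence [Lam ^+ 2]. *)
Lemma sample_size_le (L i q Lam K u : R) :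
  0 <= L -> 1 <= i -> 0 <= q -> 1 <= Lam -> 1 <= K ->
  0 <= u -> u <= 1 + K * q * Lam ->
  80 * L * u * i + 1600 * L * u ^+ 2 <=
  (80 * K + 3200 * K ^+ 2) * (L * (i + i * q + q ^+ 2) * Lam ^+ 2).
Proof.
move=> L0 i1 q0 Lam1 K1 u0 uK.
have KL1 : 1 <= K * Lam by rewrite -[leLHS]mulr1 ler_pM.
have KL2 : 1 <= (K * Lam) ^+ 2 by rewrite exprn_ege1.
have Lam2 : Lam <= Lam ^+ 2 by rewrite expr2 ler_peMl//; lra.
have iq0 : 0 <= i * q by rewrite mulr_ge0//; lra.
have q2 := sqr_ge0 q.
set W := i + i * q + q ^+ 2.
have t1 : u * i <= K * (W * Lam ^+ 2).
  apply: (@le_trans _ _ (K * Lam * (i + i * q))).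
    apply: (@le_trans _ _ ((1 + K * q * Lam) * i)); first by rewrite ler_wpM2r//; lra.
    have : i <= K * Lam * i by rewrite ler_peMl//; lra.
    by lra.
  rewrite -mulrA ler_wpM2l//; first lra.
  by rewrite mulrC ler_pM// /W; lra.
have t2 : u ^+ 2 <= 2 * K ^+ 2 * (W * Lam ^+ 2).
  apply: (@le_trans _ _ (2 + 2 * (K * Lam) ^+ 2 * q ^+ 2)).
    apply: (@le_trans _ _ ((1 + K * q * Lam) ^+ 2)).
      by rewrite lerXn2r ?nnegrE//; lra.
    by have := sqr_ge0 (1 - K * q * Lam); rewrite !expr2; lra.
  (* The constant [1] is absorbed by the summand [i] of [W], as [1 <= i]. *)
  have : (K * Lam) ^+ 2 * (1 + q ^+ 2) <= (K * Lam) ^+ 2 * W.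
    by rewrite ler_wpM2l ?sqr_ge0// /W; lra.
  by rewrite exprMn in KL2 *; lra.
have l1 : L * (u * i) <= L * (K * (W * Lam ^+ 2)) by rewrite ler_wpM2l.
have l2 : L * u ^+ 2 <= L * (2 * K ^+ 2 * (W * Lam ^+ 2)) by rewrite ler_wpM2l.
by lra.
Qed.

End sample_size.

(** * From scores to signed expectations *)

Section score_gap.
Context (R : realType) (d : measure_display) (Z : measurableType d).
Context (H : finType) (psi : H -> H -> Z -> R) (D : probability Z R).
Hypothesis measurable_psi : forall h h' : H, measurable_fun [set: Z] (psi h h').
Hypothesis psi_bound : forall (h h' : H) (z : Z), -1 <= psi h h' z <= 1.

Lemma integrable_psi h h' : D.-integrable [set: Z] (EFin \o psi h h').
Proof.
apply: (@probability_bounded_integrable _ _ _ _ _ 1) => // z.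
by rewrite ler_norml psi_bound.
Qed.

(** Boundedness of [psi] makes every [pscore] finite, and the default [-oo] of the maximum lies
    below [a], so a singleton [H] fits in as well. *)
Lemma score_leP (h : H) (a : R) :
  reflect (forall h', h' != h -> \int[D]_z psi h h' z <= a)
          (score psi D h <= a%:E)%E.
Proof.
have pscoreE h' : pscore psi D h h' = (\int[D]_z psi h h' z)%:E.
  rewrite /pscore unlock -EFin_Rintegral//.
  exact: integrable_psi.
apply: (iffP (bigmax_leP _ _ _ _)) => [[_ le_a] h' h'h|le_a].
  by have := le_a _ h'h; rewrite pscoreE lee_fin.
by split => [|h' h'h]; rewrite ?leNye// pscoreE lee_fin le_a.
Qed.

(* On the diagonal, which the score ignores, the comparison is replaced by its
   most favourable value. *)
Definition centered (alpha : R) (h h' : H) (z : Z) : R :=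
  (if h' == h then -1 else psi h h' z) - 3 * alpha / 10.

Lemma measurable_centered alpha h h' :
  measurable_fun [set: Z] (centered alpha h h').
Proof. by rewrite /centered; case: eqP => _; apply: measurable_funB. Qed.

Lemma normr_centered alpha h h' z : 0 < alpha <= 2^-1 ->
  `|centered alpha h h' z| <= 2.
Proof.
move=> /andP[a0 a12]; rewrite /centered ler_norml.
by case: eqP => _; have := psi_bound h h' z; lra.
Qed.

(** The shift [3 * alpha / 10] is the midpoint of [alpha / 10] and [alpha / 2], which leaves the
    margin [alpha / 5] on either side. The diagonal value [-1] is below this margin too. *)
Lemma integral_centered_le alpha h h' : 0 < alpha ->
  (score psi D h <= (alpha / 10)%:E)%E ->
  \int[D]_z centered alpha h h' z <= - (alpha / 5).
Proof.
move=> a0 /score_leP h_le; rewrite /centered.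
have [_|h'h] := eqVneq h' h; first by rewrite Rintegral_probability_cst; lra.
rewrite Rintegral_probabilityDr; last exact: integrable_psi.
by have := h_le _ h'h; lra.
Qed.

Lemma integral_centered_ge alpha h : ~~ (score psi D h <= (alpha / 2)%:E)%E ->
  exists h', alpha / 5 <= \int[D]_z centered alpha h h' z.
Proof.
move=> /score_leP /existsNP[h' /not_implyP[h'h /negP]]; rewrite -ltNge => lt_h'.
exists h'; rewrite /centered (negbTE h'h) Rintegral_probabilityDr.
  by lra.
exact: integrable_psi.
Qed.

End score_gap.

(** * Choice of the temperature and of the sample size *)

Section temperature.
Context {R : realType}.

(* The first summand bounds the privacy loss; the second makes the quadratic term
   of the exponential moment at most half of the linear one. *)
Definition inverse_temperature (eps delta tau : R) : R :=
  (4 * tau / eps + 16 * tau ^+ 2 / delta)^-1.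

Lemma inverse_temperature_bounds (eps delta tau : R) :
  0 < eps -> 0 < delta -> 0 < tau ->
  let lam := inverse_temperature eps delta tau in
  [/\ 0 < lam, 4 * lam * tau <= eps & 16 * lam * tau ^+ 2 <= delta].
Proof.
move=> e0 d0 t0 lam.
have t2 : 0 < tau ^+ 2 by rewrite exprn_gt0.
have A0 : 0 < 4 * tau / eps by rewrite divr_gt0//; lra.
have B0 : 0 < 16 * tau ^+ 2 / delta by rewrite divr_gt0//; lra.
have l0 : 0 < lam by rewrite invr_gt0; lra.
split => //.
- have : lam * (4 * tau / eps) <= 1.
    by rewrite /lam /inverse_temperature mulrC ler_pdivrMr; lra.
  by rewrite mulrA ler_pdivrMr//; lra.
- have : lam * (16 * tau ^+ 2 / delta) <= 1.
    by rewrite /lam /inverse_temperature mulrC ler_pdivrMr; lra.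
  by rewrite mulrA ler_pdivrMr//; lra.
Qed.

End temperature.

(** The constant of [sample_size_le] at [K = 656], the value supplied by [clip_level_ratio_le]. *)
Definition sample_constant (R : realType) : R := 80 * 656 + 3200 * 656 ^+ 2.

(** Once [n * lam * delta / 2] reaches [2 * L], with [delta = alpha / 5], the exponential is at most
    [(beta / k) ^+ 2]. This cancels the number of pairs and leaves [beta ^+ 2 <= beta]. *)
Lemma sample_size_suffices (R : realType) (eps alpha beta : R) (k m n : nat) :
  0 < eps <= 2^-1 -> 0 < alpha <= 2^-1 -> 0 < beta <= 2^-1 ->
  (0 < k)%N -> (0 < m)%N ->
  let g := selection_rate (SelectionParams eps alpha beta k m) in
  let lam := inverse_temperature eps (alpha / 5) (clip_level (alpha / 5) m) in
  sample_constant R * (g * (1 + `|ln g|) ^+ 2) <= n%:R ->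
  k%:R ^+ 2 * expR (- (lam * (alpha / 5) / 2)) ^+ n <= beta.
Proof.
move=> he ha hb k0 m0 g; set tau := clip_level (alpha / 5) m; move=> lam nge.
have [L12 g1 _] := selection_rate_bounds he ha hb k0 m0.
have ule := clip_level_ratio_le he ha hb k0 m0.
rewrite -/g in g1 ule.
case/andP: he => e0 e12; case/andP: ha => a0 a12; case/andP: hb => b0 b12.
rewrite -/tau in ule.
have d0 : 0 < alpha / 5 by rewrite divr_gt0.
have t0 : 0 < tau by rewrite (lt_le_trans d0)// clip_level_ge.
have [l0 _ _] := inverse_temperature_bounds e0 d0 t0; rewrite -/lam in l0.
set L := ln _ in L12; set q := (alpha * _)^-1 in ule.
have q0 : 0 <= q by rewrite invr_ge0 mulr_ge0// ltW.
have i1 : 1 <= eps^-1 by rewrite invf_ge1//; lra.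
have gE : g = L * (eps^-1 + eps^-1 * q + q ^+ 2) by rewrite /g selection_rateE.
have L0 : 0 <= L by lra.
have u0 : 0 <= tau / alpha by rewrite divr_ge0// ltW.
have Lam1 : 1 <= 1 + `|ln g| by rewrite lerDl.
have K1 : 1 <= 656 :> R by rewrite ler1n.
have := sample_size_le L0 i1 q0 Lam1 K1 u0 ule.
rewrite -gE -/(sample_constant R) => /le_trans /(_ nge) size_le.
have nL : 2 * L <= n%:R * (lam * (alpha / 5) / 2).
  set w := 4 * tau / eps + 16 * tau ^+ 2 / (alpha / 5).
  have lamE : lam = w^-1 by [].
  have w0 : 0 < w by rewrite -invr_gt0.
  have -> : n%:R * (lam * (alpha / 5) / 2) = n%:R * (alpha / 5 / 2) / w.
    by rewrite lamE; ring.
  rewrite ler_pdivlMr//; move: size_le.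
  (* Expanding the inverse temperature [w] explains the coefficients: [4 * 4 * 5 = 80] and
     [4 * 16 * 25 = 1600]. *)
  have -> : 80 * L * (tau / alpha) / eps + 1600 * L * (tau / alpha) ^+ 2 =
      4 * L * w / (alpha / 5).
    by rewrite /w; field; rewrite !gt_eqF.
  by rewrite ler_pdivrMr//; lra.
have k1 : 0 < k%:R :> R by rewrite ltr0n.
rewrite -expRM_natl mulrN.
apply: (@le_trans _ _ (k%:R ^+ 2 * expR (- (2 * L)))).
  by rewrite ler_wpM2l ?sqr_ge0// ler_expR lerN2.
rewrite expRN expRM_natl lnK ?posrE ?divr_gt0// expr_div_n invf_div mulrCA.
rewrite divff ?mulr1 ?gt_eqF ?exprn_gt0// expr2 ler_piMl//; lra.
Qed.

(** The difference has mean at most [- delta], and its quadratic correction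
    [8 * lam ^+ 2 * tau ^+ 2] uses up at most half of [lam * delta]. No independence of [Y1] and
    [Y2] is involved. *)
Lemma integral_expR_gap_le (R : realType) (d : measure_display)
    (T : measurableType d) (P : probability T R) (Y1 Y2 : T -> R)
    (lam tau delta : R) :
  measurable_fun [set: T] Y1 -> measurable_fun [set: T] Y2 ->
  (forall t, `|Y1 t| <= tau) -> (forall t, `|Y2 t| <= tau) ->
  \int[P]_t Y1 t <= - (delta / 2) -> delta / 2 <= \int[P]_t Y2 t ->
  0 <= lam -> 4 * lam * tau <= 1 -> 16 * lam * tau ^+ 2 <= delta ->
  (\int[P]_t (expR (lam * (Y1 t - Y2 t)))%:E
    <= (expR (- (lam * delta / 2)))%:E)%E.
Proof.
move=> mY1 mY2 Y1tau Y2tau Y1le Y2ge lam0 lamtau lamtau2.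
have i1 := probability_bounded_integrable P mY1 Y1tau.
have i2 := probability_bounded_integrable P mY2 Y2tau.
have mY : measurable_fun [set: T] (fun t => Y1 t - Y2 t) by exact: measurable_funB.
have Y2tau' t : `|Y1 t - Y2 t| <= 2 * tau.
  by rewrite (le_trans (ler_normB _ _))//; have := Y1tau t; have := Y2tau t; lra.
have YB t : `|lam * (Y1 t - Y2 t)| <= 2 * lam * tau.
  by rewrite normrM ger0_norm// [leRHS](_ : _ = lam * (2 * tau)) ?ler_wpM2l//; ring.
apply: (@le_trans _ _ (1 + - (lam * delta) + 2 * (2 * lam * tau) ^+ 2)%:E).
  apply: integral_expR_le => //; [exact: measurable_funM|lra|].
  rewrite RintegralZl//; last exact: probability_bounded_integrable mY Y2tau'.
  by rewrite RintegralB// -mulrN ler_wpM2l//; lra.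
rewrite lee_fin (le_trans _ (expR_ge1Dx _))//.
have : lam * (16 * lam * tau ^+ 2) <= lam * delta by rewrite ler_wpM2l.
by rewrite !expr2; lra.
Qed.

(** * Assembly of the private selection algorithm *)

Theorem theoremE1 (R : realType) :
  exists n0 : selection_params R -> R,
    is_Theta_tilde [set p | admissible p] n0 (@selection_rate R) /\
    forall (eps alpha beta : R),
      0 < eps <= 2^-1 -> 0 < alpha <= 2^-1 -> 0 < beta <= 2^-1 ->
    forall (d : measure_display) (Z : measurableType d)
      (H : finType) (h0 : H) (psi : H -> H -> Z -> R),
      (forall h h' : H, measurable_fun [set: Z] (psi h h')) ->
      (forall (h h' : H) (z : Z), -1 <= psi h h' z <= 1) ->
    forall n m : nat, (0 < m)%N ->
      n0 (SelectionParams eps alpha beta #|H| m) <= n%:R ->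
    exists A : R.-pker (n.-tuple (m.-tuple Z)) ~> discrete h0,
      user_level_DP eps A /\
      forall D : probability Z R,
        (exists hstar : H, (score psi D hstar <= (alpha / 10)%:E)%E) ->
        ((1 - beta)%:E <=
          \int[iid (iid D m) n]_x
            A x [set h : H | (score psi D h <= (alpha / 2)%:E)%E])%E.
Proof.
exists (fun p => sample_constant R *
  (selection_rate p * (1 + `|ln (selection_rate p)|) ^+ 2)); split.
  have C0 : 0 < sample_constant R.
    by rewrite /sample_constant; have := sqr_ge0 (656 : R); lra.
  (* The threshold is the rate times its own squared logarithmic factor, so the upper bound is an
     equality and the lower one follows from [Lam >= 1]. *)
  exists (sample_constant R), (sample_constant R), 2; split => //.
  case=> eps alpha beta k m [/= he ha hb k0 m0].
  have [_ g1 _] := selection_rate_bounds he ha hb k0 m0.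
  set g := selection_rate _ in g1 *; set Lam := (1 + _) ^+ 2.
  have Lam1 : 1 <= Lam by rewrite exprn_ege1// lerDl.
  rewrite lexx andbT ler_pM2l// ler_pM2l; last lra.
  by rewrite (le_trans _ Lam1)// invf_le1//; lra.
move=> eps alpha beta he ha hb d Z H h0 psi mpsi psi1 n m m0 nge.
have H0 : (0 < #|H|)%N by apply/card_gt0P; exists h0.
have size_ok := sample_size_suffices he ha hb H0 m0 nge.
have e0 : 0 < eps by case/andP: he.
have a0 : 0 < alpha by case/andP: ha.
set delta := alpha / 5 in size_ok; set tau := clip_level delta m in size_ok.
set lam := inverse_temperature eps delta tau in size_ok.
have d0 : 0 < delta by rewrite divr_gt0.
have t0 : 0 < tau by rewrite (lt_le_trans d0)// clip_level_ge.
have [l0 lameps lamdelta] := inverse_temperature_bounds e0 d0 t0.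
rewrite -/lam in l0 lameps lamdelta.
(* A whole user is one sample point of the mechanism, so changing one coordinate of its input is a
   user-level change. *)
pose c h h' (t : m.-tuple Z) := clip tau (tuple_mean (centered psi alpha h h') t).
have mcent := measurable_centered mpsi alpha.
have mc h h' : measurable_fun [set: m.-tuple Z] (c h h').
  apply: measurableT_comp; first exact: measurable_clip.
  exact: measurable_tuple_mean.
have ctau h h' t : `|c h h' t| <= tau by rewrite normr_clip// ltW.
have [A AE] := @finite_pkerP _ _ _ _ h0 (@soft_pmf _ _ _ _ c lam n)
  (@measurable_soft_pmf _ _ _ _ c lam n mc) (@soft_pmf_ge0 _ _ _ _ c lam n)
  (@sum_soft_pmf _ _ _ _ c lam n h0).
exists A; split.
  move=> x x' [i xx'] S mS; rewrite !AE -EFinM lee_fin mulr_sumr ler_sum// => h _.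
  rewrite mulrA ler_wpM2r//.
  rewrite (le_trans (soft_pmf_neighbor_le h (ltW l0) ctau xx'))//.
  by rewrite ler_wpM2r ?soft_pmf_ge0// ler_expR.
move=> D [hs hs_le].
pose bad h := ~~ (score psi D h <= (alpha / 2)%:E)%E.
(* [g] picks a competitor that exposes a bad candidate; on good candidates it takes the dummy value
   [h]. *)
have /choice[g gP] : forall h, exists h', bad h ->
    delta <= \int[D]_z centered psi alpha h h' z.
  move=> h; have [hbad|_] := boolP (bad h); last by exists h.
  by have [h' h'_ge] := integral_centered_ge mpsi psi1 hbad; exists h'.
have cent2 h h' z : `|centered psi alpha h h' z| <= 2 by exact: normr_centered.
have gap h h' : bad h -> (\int[iid D m]_t (expR (lam * (c hs h' t - c h (g h) t)))%:E
    <= (expR (- (lam * delta / 2)))%:E)%E.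
  move=> hbad; apply: (@integral_expR_gap_le _ _ _ _ _ _ _ tau) => //.
  - exact/clipped_mean_le/integral_centered_le.
  - exact/clipped_mean_ge/gP.
  - exact: ltW.
  (* The smallness condition on [lam] follows from the privacy condition:
     [4 * lam * tau <= eps <= 1/2]. *)
  - by case/andP: he; lra.
pose b (x : n.-tuple (m.-tuple Z)) := \sum_(h | bad h) soft_pmf c lam x h.
have b0 x : 0 <= b x by rewrite sumr_ge0// => h _; exact: soft_pmf_ge0.
have mb : measurable_fun [set: n.-tuple (m.-tuple Z)] b.
  exact: measurable_sum_soft_pmf.
have b_le : (\int[iid (iid D m) n]_x (b x)%:E <= beta%:E)%E.
  apply: (le_trans (@integral_soft_pmf_le _ _ _ _ c lam n mc _ hs bad g _
    gap (expR_ge0 _))).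
  by rewrite lee_fin.
have [intb {}b_le] := ge0_integrable_le mb b0 b_le.
(* The success probability is the complement of the mass on bad candidates, whose expectation is
   already at most [beta]. *)
have AgoodE x : A x [set h : H | (score psi D h <= (alpha / 2)%:E)%E] =
    (1 - b x)%:E.
  rewrite AE -[in RHS](sum_soft_pmf c lam h0 x) (bigID bad)/= big1 ?add0r.
    rewrite [in RHS](bigID bad)/= -/(b x) addrAC subrr add0r; congr EFin.
    apply: eq_bigr => h; rewrite negbK => hgood.
    by rewrite indicE mem_set// mulr1.
  move=> h hbad; rewrite indicE memNset ?mulr0//=.
  exact/negP.
rewrite (eq_integral _ _ (fun x _ => AgoodE x)).
have intNb : (iid (iid D m) n).-integrable setT (EFin \o (fun x => - b x)).
  by have := integrable_mulr (-1) intb; under eq_fun do rewrite /= mulN1r.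
rewrite (_ : (fun x => (1 - b x)%:E) = (fun x => (- b x + 1)%:E)); last first.
  by apply/funext => x; rewrite addrC.
rewrite EFin_Rintegral; last first.
  by apply: integrable_addr => //; exact: probability_integrable_cst.
rewrite lee_fin Rintegral_probabilityDr//.
by rewrite RintegralN//; lra.
Qed.
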